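(* Let $F$ be a field of characteristic $0$, let $k\ge 0$ and $n\in\{4k+2,4k+3\}$. Then for any $a\in Alt[X]$ and any $x_1,\ldots,x_n\in X$, $$u_n(a;x_1,\ldots,x_n):=\bigl([a,x_1,\ldots,x_{n-1}],a^2,x_n\bigr)-\bigl([a^2,x_1,\ldots,x_{n-1}],a,x_n\bigr)=0 .$$
   Context: $X=\{x_1,x_2,\ldots\}$ is a countably infinite set of free generators and $Alt[X]$ is the free alternative $F$-algebra on $X$. Commutator $[p,q]=pq-qp$; long commutators are left-normed, $[p,q_1,\ldots,q_k]=[\ldots[[p,q_1],q_2],\ldots,q_k]$. Associator: $(p,q,r)=(pq)r-p(qr)$. *)

(* Defs.v *)
From HB Require Import structures.
From mathcomp Require Import all_boot all_algebra.
From mathcomp Require Import boolp.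

Set Implicit Arguments.
Unset Strict Implicit.
Unset Printing Implicit Defensive.

Import GRing.Theory.
Local Open Scope ring_scope.

(* Not necessarily associative, not necessarily unital algebras; the ring
   structures of ssralg all require associativity, hence a separate product. *)

HB.mixin Record isNAAlgebra (F : fieldType) A of GRing.Lmodule F A := {
  na_mul : A -> A -> A;
  na_mulDl : forall u v w : A, na_mul (u + v) w = na_mul u w + na_mul v w;
  na_mulDr : forall u v w : A, na_mul u (v + w) = na_mul u v + na_mul u w;
  na_scaleAl : forall (c : F) (u v : A), na_mul (c *: u) v = c *: na_mul u v;
  na_scaleAr : forall (c : F) (u v : A), na_mul u (c *: v) = c *: na_mul u v
}.

#[short(type="naAlgType")]
HB.structure Definition NAAlgebra (F : fieldType) :=
  { A of GRing.Lmodule F A & isNAAlgebra F A }.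

Notation "u ** v" := (na_mul u v) (at level 40, left associativity) : ring_scope.

HB.mixin Record isAlternative (F : fieldType) A of NAAlgebra F A := {
  na_altl : forall u v : A, (u ** u) ** v = u ** (u ** v);
  na_altr : forall u v : A, (u ** v) ** v = u ** (v ** v)
}.

#[short(type="altAlgType")]
HB.structure Definition AltAlgebra (F : fieldType) :=
  { A of NAAlgebra F A & isAlternative F A }.

Section Operations.
Variables (F : fieldType) (A : naAlgType F).
Implicit Types u v w : A.

Definition na_comm u v : A := u ** v - v ** u.
Definition na_assoc u v w : A := (u ** v) ** w - u ** (v ** w).
Definition na_lcomm u (vs : seq A) : A := foldl na_comm u vs.

(* The entries of x are numbered from 1: only x 1, ..., x n are used. *)
Definition na_u (n : nat) (a : A) (x : nat -> A) : A :=
  na_assoc (na_lcomm a [seq x i | i <- index_iota 1 n]) (a ** a) (x n)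
  - na_assoc (na_lcomm (a ** a) [seq x i | i <- index_iota 1 n]) a (x n).

End Operations.

(* The free alternative algebra on X: formal expressions in the operations of
   an algebra, modulo the least congruence that contains all instances of the
   algebra axioms and of the two alternative laws. *)

Inductive alt_term (F : fieldType) (X : Type) : Type :=
| AltVar of X
| AltZero
| AltOpp of alt_term F X
| AltAdd of alt_term F X & alt_term F X
| AltScale of F & alt_term F X
| AltMul of alt_term F X & alt_term F X.
Arguments AltVar {F X}.
Arguments AltZero {F X}.

HB.instance Definition _ (F : fieldType) (X : Type) :=
  gen_eqMixin (alt_term F X).
HB.instance Definition _ (F : fieldType) (X : Type) :=
  gen_choiceMixin (alt_term F X).

Inductive alt_cong (F : fieldType) (X : Type) :
    alt_term F X -> alt_term F X -> Prop :=
| AcRefl s : alt_cong s s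
| AcSym s t : alt_cong s t -> alt_cong t s
| AcTrans s t r : alt_cong s t -> alt_cong t r -> alt_cong s r
| AcOpp s t : alt_cong s t -> alt_cong (AltOpp s) (AltOpp t)
| AcAdd s s' t t' : alt_cong s s' -> alt_cong t t' ->
    alt_cong (AltAdd s t) (AltAdd s' t')
| AcScale c s t : alt_cong s t -> alt_cong (AltScale c s) (AltScale c t)
| AcMul s s' t t' : alt_cong s s' -> alt_cong t t' ->
    alt_cong (AltMul s t) (AltMul s' t')
| AcAddA s t r : alt_cong (AltAdd s (AltAdd t r)) (AltAdd (AltAdd s t) r)
| AcAddC s t : alt_cong (AltAdd s t) (AltAdd t s)
| AcAdd0 s : alt_cong (AltAdd AltZero s) s
| AcAddN s : alt_cong (AltAdd (AltOpp s) s) AltZero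
| AcScaleA c d s : alt_cong (AltScale c (AltScale d s)) (AltScale (c * d) s)
| AcScale1 s : alt_cong (AltScale 1 s) s
| AcScaleDr c s t :
    alt_cong (AltScale c (AltAdd s t)) (AltAdd (AltScale c s) (AltScale c t))
| AcScaleDl c d s :
    alt_cong (AltScale (c + d) s) (AltAdd (AltScale c s) (AltScale d s))
| AcMulDl s t r :
    alt_cong (AltMul (AltAdd s t) r) (AltAdd (AltMul s r) (AltMul t r))
| AcMulDr s t r :
    alt_cong (AltMul s (AltAdd t r)) (AltAdd (AltMul s t) (AltMul s r))
| AcScaleAl c s t :
    alt_cong (AltMul (AltScale c s) t) (AltScale c (AltMul s t))
| AcScaleAr c s t :
    alt_cong (AltMul s (AltScale c t)) (AltScale c (AltMul s t))
| AcAltl s t : alt_cong (AltMul (AltMul s s) t) (AltMul s (AltMul s t))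
| AcAltr s t : alt_cong (AltMul (AltMul s t) t) (AltMul s (AltMul t t)).

Section FreeAlternative.
Variables (F : fieldType) (X : Type).

Definition alt_congb : rel (alt_term F X) := fun s t => `[< alt_cong s t >].

Fact alt_congb_refl : reflexive alt_congb.
Proof. by move=> s; apply/asboolP; apply: AcRefl. Qed.
Fact alt_congb_sym : symmetric alt_congb.
Proof. by move=> s t; apply/asboolP/asboolP; apply: AcSym. Qed.
Fact alt_congb_trans : transitive alt_congb.
Proof.
by move=> t s r /asboolP st /asboolP tr; apply/asboolP; apply: AcTrans st tr.
Qed.

Definition alt_equiv : equiv_rel (alt_term F X) :=
  EquivRel alt_congb alt_congb_refl alt_congb_sym alt_congb_trans.

Definition freeAlt : Type := {eq_quot alt_equiv}%qT.
HB.instance Definition _ := Choice.on freeAlt.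

Definition alt_class (s : alt_term F X) : freeAlt :=
  (\pi_({eq_quot alt_equiv}%qT) s)%qT.
Definition alt_repr (u : freeAlt) : alt_term F X :=
  repr (u : {eq_quot alt_equiv}%qT).

Lemma alt_reprK u : alt_class (alt_repr u) = u.
Proof. exact: reprK. Qed.

Lemma alt_classP s t : alt_class s = alt_class t <-> alt_cong s t.
Proof.
split=> [/eqquotP/asboolP //|st].
by apply/eqquotP; apply/asboolP.
Qed.

Lemma alt_repr_cong s : alt_cong (alt_repr (alt_class s)) s.
Proof. by apply/alt_classP; rewrite alt_reprK. Qed.

Definition freeAlt_gen (x : X) : freeAlt := alt_class (AltVar x).
Definition freeAlt_zero : freeAlt := alt_class AltZero.
Definition freeAlt_opp (u : freeAlt) : freeAlt :=
  alt_class (AltOpp (alt_repr u)).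
Definition freeAlt_add (u v : freeAlt) : freeAlt :=
  alt_class (AltAdd (alt_repr u) (alt_repr v)).
Definition freeAlt_scale (c : F) (u : freeAlt) : freeAlt :=
  alt_class (AltScale c (alt_repr u)).
Definition freeAlt_mul (u v : freeAlt) : freeAlt :=
  alt_class (AltMul (alt_repr u) (alt_repr v)).

Lemma freeAlt_oppE s : freeAlt_opp (alt_class s) = alt_class (AltOpp s).
Proof. by apply/alt_classP/AcOpp/alt_repr_cong. Qed.
Lemma freeAlt_addE s t :
  freeAlt_add (alt_class s) (alt_class t) = alt_class (AltAdd s t).
Proof. by apply/alt_classP/AcAdd; apply: alt_repr_cong. Qed.
Lemma freeAlt_scaleE c s :
  freeAlt_scale c (alt_class s) = alt_class (AltScale c s).
Proof. by apply/alt_classP/AcScale/alt_repr_cong. Qed.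
Lemma freeAlt_mulE s t :
  freeAlt_mul (alt_class s) (alt_class t) = alt_class (AltMul s t).
Proof. by apply/alt_classP/AcMul; apply: alt_repr_cong. Qed.

Let opE :=
  (freeAlt_oppE, freeAlt_addE, freeAlt_scaleE, freeAlt_mulE).

Fact freeAlt_addA : associative freeAlt_add.
Proof.
move=> u v w; rewrite -[u]alt_reprK -[v]alt_reprK -[w]alt_reprK !opE.
exact/alt_classP/AcAddA.
Qed.
Fact freeAlt_addC : commutative freeAlt_add.
Proof.
move=> u v; rewrite -[u]alt_reprK -[v]alt_reprK !opE.
exact/alt_classP/AcAddC.
Qed.
Fact freeAlt_add0 : left_id freeAlt_zero freeAlt_add.
Proof.
by move=> u; rewrite -[u]alt_reprK !opE; apply/alt_classP/AcAdd0.
Qed.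
Fact freeAlt_addN : left_inverse freeAlt_zero freeAlt_opp freeAlt_add.
Proof.
by move=> u; rewrite -[u]alt_reprK !opE; apply/alt_classP/AcAddN.
Qed.

HB.instance Definition _ := GRing.isZmodule.Build freeAlt
  freeAlt_addA freeAlt_addC freeAlt_add0 freeAlt_addN.

Fact freeAlt_scaleA c d u :
  freeAlt_scale c (freeAlt_scale d u) = freeAlt_scale (c * d) u.
Proof. by rewrite -[u]alt_reprK !opE; apply/alt_classP/AcScaleA. Qed.
Fact freeAlt_scale1 : left_id 1 freeAlt_scale.
Proof.
by move=> u; rewrite -[u]alt_reprK !opE; apply/alt_classP/AcScale1.
Qed.
Fact freeAlt_scaleDr : right_distributive freeAlt_scale +%R.
Proof.
move=> c u v; rewrite /GRing.add /= -[u]alt_reprK -[v]alt_reprK !opE.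
exact/alt_classP/AcScaleDr.
Qed.
Fact freeAlt_scaleDl u : {morph freeAlt_scale^~ u : c d / c + d}.
Proof.
move=> c d; rewrite [RHS]/GRing.add /= -[u]alt_reprK !opE.
exact/alt_classP/AcScaleDl.
Qed.

HB.instance Definition _ := GRing.Zmodule_isLmodule.Build F freeAlt
  freeAlt_scaleA freeAlt_scale1 freeAlt_scaleDr freeAlt_scaleDl.

Fact freeAlt_mulDl u v w :
  freeAlt_mul (u + v) w = freeAlt_mul u w + freeAlt_mul v w.
Proof.
rewrite /GRing.add /= -[u]alt_reprK -[v]alt_reprK -[w]alt_reprK !opE.
exact/alt_classP/AcMulDl.
Qed.
Fact freeAlt_mulDr u v w :
  freeAlt_mul u (v + w) = freeAlt_mul u v + freeAlt_mul u w.
Proof.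
rewrite /GRing.add /= -[u]alt_reprK -[v]alt_reprK -[w]alt_reprK !opE.
exact/alt_classP/AcMulDr.
Qed.
Fact freeAlt_scaleAl c u v : freeAlt_mul (c *: u) v = c *: freeAlt_mul u v.
Proof.
rewrite /GRing.scale /= -[u]alt_reprK -[v]alt_reprK !opE.
exact/alt_classP/AcScaleAl.
Qed.
Fact freeAlt_scaleAr c u v : freeAlt_mul u (c *: v) = c *: freeAlt_mul u v.
Proof.
rewrite /GRing.scale /= -[u]alt_reprK -[v]alt_reprK !opE.
exact/alt_classP/AcScaleAr.
Qed.

HB.instance Definition _ := isNAAlgebra.Build F freeAlt
  freeAlt_mulDl freeAlt_mulDr freeAlt_scaleAl freeAlt_scaleAr.

Fact freeAlt_altl (u v : freeAlt) : (u ** u) ** v = u ** (u ** v).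
Proof.
rewrite /na_mul /= -[u]alt_reprK -[v]alt_reprK !opE.
exact/alt_classP/AcAltl.
Qed.
Fact freeAlt_altr (u v : freeAlt) : (u ** v) ** v = u ** (v ** v).
Proof.
rewrite /na_mul /= -[u]alt_reprK -[v]alt_reprK !opE.
exact/alt_classP/AcAltr.
Qed.

HB.instance Definition _ := isAlternative.Build F freeAlt
  freeAlt_altl freeAlt_altr.

End FreeAlternative.

Arguments freeAlt_gen {F X} x.

Section Universal.
Variables (F : fieldType) (X : Type) (A : altAlgType F) (f : X -> A).

Fixpoint alt_eval (s : alt_term F X) : A :=
  match s with
  | AltVar x => f x
  | AltZero => 0
  | AltOpp t => - alt_eval t
  | AltAdd t r => alt_eval t + alt_eval r
  | AltScale c t => c *: alt_eval t
  | AltMul t r => alt_eval t ** alt_eval r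
  end.

Lemma alt_eval_cong s t : alt_cong s t -> alt_eval s = alt_eval t.
Proof.
elim=> //=.
- by move=> ? ? ? _ -> _ ->.
- by move=> ? ? _ ->.
- by move=> ? ? ? ? _ -> _ ->.
- by move=> ? ? ? _ ->.
- by move=> ? ? ? ? _ -> _ ->.
- by move=> *; rewrite addrA.
- by move=> *; rewrite addrC.
- by move=> *; rewrite add0r.
- by move=> *; rewrite addNr.
- by move=> *; rewrite scalerA.
- by move=> *; rewrite scale1r.
- by move=> *; rewrite scalerDr.
- by move=> *; rewrite scalerDl.
- by move=> *; rewrite na_mulDl.
- by move=> *; rewrite na_mulDr.
- by move=> *; rewrite na_scaleAl.
- by move=> *; rewrite na_scaleAr.
- by move=> *; rewrite na_altl.
- by move=> *; rewrite na_altr.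
Qed.

Definition freeAlt_lift (u : freeAlt F X) : A := alt_eval (alt_repr u).

Lemma freeAlt_liftE s : freeAlt_lift (alt_class s) = alt_eval s.
Proof. exact/alt_eval_cong/alt_repr_cong. Qed.

Lemma freeAlt_lift_gen x : freeAlt_lift (freeAlt_gen x) = f x.
Proof. exact: freeAlt_liftE. Qed.

Lemma freeAlt_lift_linear : linear freeAlt_lift.
Proof.
move=> c u v; rewrite -[u]alt_reprK -[v]alt_reprK.
have -> : c *: alt_class (alt_repr u) + alt_class (alt_repr v)
    = freeAlt_add (freeAlt_scale c (alt_class (alt_repr u)))
                  (alt_class (alt_repr v)) by [].
by rewrite freeAlt_scaleE freeAlt_addE !freeAlt_liftE.
Qed.

Lemma freeAlt_lift_mul u v :
  freeAlt_lift (u ** v) = freeAlt_lift u ** freeAlt_lift v.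
Proof. exact: freeAlt_liftE. Qed.

Lemma freeAlt_lift_unique (g : freeAlt F X -> A) :
  linear g -> {morph g : u v / u ** v >-> u ** v} ->
  (forall x, g (freeAlt_gen x) = f x) -> g =1 freeAlt_lift.
Proof.
move=> gL gM gX u; rewrite -[u]alt_reprK freeAlt_liftE.
have gD v w : g (v + w) = g v + g w by rewrite -[v in LHS]scale1r gL scale1r.
have g0 : g 0 = 0 by apply: (@addIr _ (g 0)); rewrite -gD !add0r.
have gZ c v : g (c *: v) = c *: g v by rewrite -[c *: v]addr0 gL g0 addr0.
elim: (alt_repr u) => [x||s IH|s IHs t IHt|c s IH|s IHs t IHt] /=.
- exact: gX.
- exact: g0.
- rewrite -freeAlt_oppE -IH; apply: (@addIr _ (g (alt_class s))).
  by rewrite -gD !addNr g0.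
- by rewrite -freeAlt_addE -IHs -IHt -gD.
- by rewrite -freeAlt_scaleE -IH -gZ.
- by rewrite -freeAlt_mulE -IHs -IHt -gM.
Qed.

End Universal.

(* Alt[X] for X = {x_1, x_2, ...}; the generators are indexed by nat. *)
Definition AltX (F : fieldType) : altAlgType F := freeAlt F nat.

(* Main.v *)
Require Import Defs.
From HB Require Import structures.
From mathcomp Require Import all_boot all_algebra.
From mathcomp Require Import zify.

Set Implicit Arguments.
Unset Strict Implicit.
Unset Printing Implicit Defensive.

Import GRing.Theory.
Local Open Scope ring_scope.

(** Let a and b be elements of an alternative algebra over a field of
    characteristic 0 with (a,b,z) = 0 for all z; the theorem is the case
    b = a^2. For words s and t put
      phi s t z = ([a,s],[b,t],z) - ([b,s],[a,t],z),
    so that u_n(a;x_1,...,x_n) is phi s [::] x_n for the word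
    s = x_1 ... x_(n-1), and phi s t = phi t s. All these functions turn out to
    be alternating in their letters, and reversing the letters then forces
    phi s [::] z to vanish if the number n of letters, z included, is 2 or 3
    modulo 4.

    Two identities valid for arbitrary p and q govern the argument. Both come
    from Kleinfeld's function f(w,x,y,z) = (wx,y,z) - x(w,y,z) - (x,y,z)w, which
    is skew-symmetric and equal to ([w,x],y,z) + ([y,z],w,x):
      ([p,y],q,y) = - [(p,q,y),y],
      2 (([p,y],q,z) - (p,[q,z],y))
        = - ((p,q,[y,z]) + [(p,q,y),z] + [y,(p,q,z)]).
    If phi with m letters (z included) takes values commuting with everything
    and vanishes when z is a commutator (phi_central m), they say that phi with
    m + 1 letters is alternating in z and the last letter of s, and that the
    last letter y of s may take the place of z while z is appended to t
    (phi_alt). These two rules generate full skew-symmetry, and, since phi is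
    symmetric in s and t, they give
      u_n(x_1,...,x_n) = u_n(x_n,...,x_1).
    The reversal of n letters has sign (-1)^(n(n-1)/2), hence u_n = 0 when
    n(n-1)/2 is odd.

    It remains to prove phi_central m for all m >= 1, by induction
    (phi_central_all). For m = 1 it holds because (a,b,z) = 0, and for m = 2 and
    m = 3 because phi vanishes there by the reversal argument. The step
    (phi_central_step) rests on the identities
      [p,(q,z,w)] = ([p,z],q,w) + (p,q,[z,w]) + [(p,q,z),w],
      [q,(p,z,w)] = - ((p,[q,z],w) + (p,q,[z,w]) + [(p,q,z),w]).
    Put r = (p,x,y). The function f also gives
      (r,q,[z,w]) + 2 ([r,q],z,w) = [(r,q,z),w] + [z,(r,q,w)],
    where [r,q] is known from the second identity. Since
    6r = [p,x,y] - [p,y,x] - [p,[x,y]], it follows that h = phi with m letters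
    satisfies
      h(..,[z,w]) = [h(..,z),w] - [h(..,w),z]
    (h_comm). Computing [(p,x,y),(q,z,w)] by either of them compares two
    placements of five letters around the same words (U4_U1_exchange), and turns
    into an alternating relation between the commutators of h with a letter
    (h_comm_sum); this relation shows that these commutators are
    skew-symmetric, and then that they are zero. *)

(** * Linear combinations of identities in a nonassociative algebra *)

(** Nonassociative polynomial expressions with integer coefficients in numbered
    variables. *)
Inductive na_expr :=
| NVar of nat
| NZero
| NOpp of na_expr
| NAdd of na_expr & na_expr
| NMul of na_expr & na_expr
| NMuln of na_expr & nat.

(** Nonassociative monomials. *)
Inductive na_mono := MVar of nat | MMul of na_mono & na_mono.

Fixpoint mono_eqb (m n : na_mono) : bool :=
  match m, n with
  | MVar i, MVar j => eqn i j
  | MMul m1 m2, MMul n1 n2 => mono_eqb m1 n1 && mono_eqb m2 n2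
  | _, _ => false
  end.

(** The expansion of an expression by bilinearity, as a list of signed
    monomials; the sign true stands for a minus. *)
Fixpoint na_expand (e : na_expr) : seq (bool * na_mono) :=
  match e with
  | NVar i => [:: (false, MVar i)]
  | NZero => [::]
  | NOpp e1 => [seq (~~ s.1, s.2) | s <- na_expand e1]
  | NAdd e1 e2 => na_expand e1 ++ na_expand e2
  | NMul e1 e2 =>
      let l2 := na_expand e2 in
      flatten [seq [seq (s.1 (+) t.1, MMul s.2 t.2) | t <- l2]
              | s <- na_expand e1]
  | NMuln e1 n => flatten (nseq n (na_expand e1))
  end.

(** Removes one occurrence of a signed monomial, if there is one. *)
Fixpoint mono_rem (b : bool) (m : na_mono) (l : seq (bool * na_mono)) :=
  if l is (c, n) :: l1 then
    if (b == c) && mono_eqb m n then Some l1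
    else omap (cons (c, n)) (mono_rem b m l1)
  else None.

(** Tests whether the signed monomials cancel in pairs; k bounds the number of
    steps. *)
Fixpoint na_cancels (k : nat) (l : seq (bool * na_mono)) : bool :=
  match k, l with
  | _, [::] => true
  | k1.+1, (b, m) :: l1 =>
      if mono_rem (~~ b) m l1 is Some l2 then na_cancels k1 l2 else false
  | 0, _ => false
  end.

Section Evaluation.
Variables (F : fieldType) (A : naAlgType F) (env : seq A).

Fixpoint na_eval (e : na_expr) : A :=
  match e with
  | NVar i => nth 0 env i
  | NZero => 0
  | NOpp e1 => - na_eval e1
  | NAdd e1 e2 => na_eval e1 + na_eval e2
  | NMul e1 e2 => na_eval e1 ** na_eval e2
  | NMuln e1 n => na_eval e1 *+ n
  end.

Fixpoint mono_eval (m : na_mono) : A :=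
  match m with
  | MVar i => nth 0 env i
  | MMul m1 m2 => mono_eval m1 ** mono_eval m2
  end.

Definition smono_eval (s : bool * na_mono) : A :=
  if s.1 then - mono_eval s.2 else mono_eval s.2.

Definition monos_eval l : A := \sum_(s <- l) smono_eval s.

Lemma na_mul0l (u : A) : 0 ** u = 0.
Proof. by apply: (@addIr _ (0 ** u)); rewrite -na_mulDl !add0r. Qed.

Lemma na_mul0r (u : A) : u ** 0 = 0.
Proof. by apply: (@addIr _ (u ** 0)); rewrite -na_mulDr !add0r. Qed.

Lemma na_mulNl (u v : A) : (- u) ** v = - (u ** v).
Proof. by rewrite -scaleN1r na_scaleAl scaleN1r. Qed.

Lemma na_mulNr (u v : A) : u ** (- v) = - (u ** v).
Proof. by rewrite -scaleN1r na_scaleAr scaleN1r. Qed.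

Lemma na_suml (I : Type) (r : seq I) (f : I -> A) (v : A) :
  (\sum_(i <- r) f i) ** v = \sum_(i <- r) f i ** v.
Proof.
elim: r => [|i r IH]; first by rewrite !big_nil na_mul0l.
by rewrite !big_cons na_mulDl IH.
Qed.

Lemma na_sumr (I : Type) (r : seq I) (f : I -> A) (v : A) :
  v ** (\sum_(i <- r) f i) = \sum_(i <- r) v ** f i.
Proof.
elim: r => [|i r IH]; first by rewrite !big_nil na_mul0r.
by rewrite !big_cons na_mulDr IH.
Qed.

Lemma monos_eval_flatten ls :
  monos_eval (flatten ls) = \sum_(l <- ls) monos_eval l.
Proof.
rewrite /monos_eval; elim: ls => [|l ls IH]; first by rewrite !big_nil.
by rewrite big_cons /= big_cat IH.
Qed.

Lemma na_expandP e : na_eval e = monos_eval (na_expand e).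
Proof.
elim: e => [i||e IH|e1 IH1 e2 IH2|e1 IH1 e2 IH2|e IH n] /=.
- by rewrite /monos_eval big_seq1.
- by rewrite /monos_eval big_nil.
- rewrite IH /monos_eval big_map -sumrN; apply: eq_bigr => -[[] m] _ //=.
  by rewrite /smono_eval /= opprK.
- by rewrite IH1 IH2 /monos_eval big_cat.
- rewrite IH1 IH2 monos_eval_flatten big_map /monos_eval na_suml.
  apply: eq_bigr => s _; rewrite na_sumr big_map.
  apply: eq_bigr => t _; rewrite /smono_eval /=.
  by case: s.1; case: t.1; rewrite /= ?na_mulNl ?na_mulNr ?opprK.
- rewrite IH monos_eval_flatten; elim: n => [|n IHn] /=.
    by rewrite big_nil mulr0n.
  by rewrite big_cons -IHn mulrS.
Qed.

Lemma mono_eqbP m n : mono_eqb m n -> m = n.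
Proof.
elim: m n => [i|m1 IH1 m2 IH2] [j|n1 n2] //=; first by move/eqnP=> ->.
by case/andP=> /IH1 -> /IH2 ->.
Qed.

Lemma mono_remP b m l l1 :
  mono_rem b m l = Some l1 ->
  monos_eval l = smono_eval (b, m) + monos_eval l1.
Proof.
rewrite /monos_eval; elim: l l1 => [//|[c n] l IH] l1 /=.
case: ifP => [/andP[/eqP -> /mono_eqbP ->] [<-]|_]; first by rewrite big_cons.
case: (mono_rem b m l) IH => //= l2 /(_ _ erefl) IH [<-].
by rewrite !big_cons IH addrCA.
Qed.

Lemma na_cancelsP k l : na_cancels k l -> monos_eval l = 0.
Proof.
elim: k l => [|k IH] [|[b m] l] //=; rewrite /monos_eval ?big_nil //.
case E: (mono_rem _ m l) => [l1|//] /IH l1_0.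
rewrite big_cons -/(monos_eval l) (mono_remP E) l1_0 addr0 /smono_eval /=.
by case: (b); rewrite /= ?addNr ?subrr.
Qed.

Lemma na_lincomb_eq (e1 e2 e3 e4 : na_expr) :
  (let l := na_expand (NAdd (NAdd e1 (NOpp e2)) (NOpp (NAdd e3 (NOpp e4)))) in
   na_cancels (size l) l) ->
  na_eval e3 = na_eval e4 -> na_eval e1 = na_eval e2.
Proof.
move=> /na_cancelsP; rewrite -na_expandP /= => D E.
by move: D; rewrite E subrr subr0 => /subr0_eq.
Qed.

End Evaluation.

(** Equations are combined by the operations below; [+], [-] and [*] build the
    proof of a linear combination of equations from their proofs. *)
Section Combinations.
Variables (V : zmodType).
Implicit Types u v : V.
Lemma eq_plus u1 v1 u2 v2 : u1 = v1 -> u2 = v2 -> u1 + u2 = v1 + v2.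
Proof. by move=> -> ->. Qed.
Lemma eq_minus u1 v1 u2 v2 : u1 = v1 -> u2 = v2 -> u1 - u2 = v1 - v2.
Proof. by move=> -> ->. Qed.
Lemma eq_times n u v : u = v -> u *+ n = v *+ n.
Proof. by move=> ->. Qed.
End Combinations.

Section Products.
Variables (F : fieldType) (A : naAlgType F).
Implicit Types u v w : A.
Lemma eq_mull w u v : u = v -> w ** u = w ** v.
Proof. by move=> ->. Qed.
Lemma eq_mulr w u v : u = v -> u ** w = v ** w.
Proof. by move=> ->. Qed.
Lemma eq_comml w u v : u = v -> na_comm w u = na_comm w v.
Proof. by move=> ->. Qed.
Lemma eq_commr w u v : u = v -> na_comm u w = na_comm v w.
Proof. by move=> ->. Qed.
Lemma eq_assocl z w u v : u = v -> na_assoc u z w = na_assoc v z w.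
Proof. by move=> ->. Qed.
End Products.

Notation "E1 [+] E2" := (eq_plus E1 E2) (at level 50, left associativity).
Notation "E1 [-] E2" := (eq_minus E1 E2) (at level 50, left associativity).
Notation "n [*] E" := (eq_times n%N E) (at level 40).

(** Reification: env lists the variables. *)
Ltac na_index x env :=
  match env with
  | x :: _ => constr:(0%N)
  | _ :: ?e => let i := na_index x e in constr:(S i)
  end.

Ltac na_add_atom x env :=
  match env with
  | _ => let i := na_index x env in env
  | _ => constr:(x :: env)
  end.

Ltac na_atoms t env :=
  lazymatch t with
  | @GRing.add _ ?a ?b => let e := na_atoms a env in na_atoms b e
  | @GRing.opp _ ?a => na_atoms a env
  | @GRing.zero _ => env
  | @GRing.natmul _ ?a _ => na_atoms a env
  | na_mul ?a ?b => let e := na_atoms a env in na_atoms b e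
  | na_comm ?a ?b => let e := na_atoms a env in na_atoms b e
  | na_assoc ?a ?b ?c =>
      let e := na_atoms a env in let e1 := na_atoms b e in na_atoms c e1
  | _ => na_add_atom t env
  end.

Ltac na_reify t env :=
  lazymatch t with
  | @GRing.add _ ?a ?b =>
      let x := na_reify a env in let y := na_reify b env in constr:(NAdd x y)
  | @GRing.opp _ ?a => let x := na_reify a env in constr:(NOpp x)
  | @GRing.zero _ => constr:(NZero)
  | @GRing.natmul _ ?a ?n => let x := na_reify a env in constr:(NMuln x n)
  | na_mul ?a ?b =>
      let x := na_reify a env in let y := na_reify b env in constr:(NMul x y)
  | na_comm ?a ?b =>
      let x := na_reify a env in let y := na_reify b env in
      constr:(NAdd (NMul x y) (NOpp (NMul y x)))
  | na_assoc ?a ?b ?c =>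
      let x := na_reify a env in let y := na_reify b env in
      let z := na_reify c env in
      constr:(NAdd (NMul (NMul x y) z) (NOpp (NMul x (NMul y z))))
  | _ => let i := na_index t env in constr:(NVar i)
  end.

(** If E proves u' = v', then na_lincomb E closes a goal u = v such that u - v
    and u' - v' have the same expansion by bilinearity. Commutators and
    associators are expanded; any other term is a variable. *)
Tactic Notation "na_lincomb" constr(E) :=
  let T := type of E in
  lazymatch T with ?u' = ?v' =>
  lazymatch goal with |- @eq ?A ?u ?v =>
    let n := constr:(@nil A) in
    let n1 := na_atoms u n in let n2 := na_atoms v n1 in
    let n3 := na_atoms u' n2 in let n4 := na_atoms v' n3 in
    let e1 := na_reify u n4 in let e2 := na_reify v n4 in
    let e3 := na_reify u' n4 in let e4 := na_reify v' n4 in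
    refine (@na_lincomb_eq _ _ n4 e1 e2 e3 e4 _ E); vm_compute; reflexivity
  end end.

(** * Identities of alternative algebras *)

Section AlternativeAlgebras.
Variables (F : fieldType) (A : altAlgType F).
Hypothesis charF0 : [pchar F] =i pred0.
Implicit Types u v w x y z p q : A.

Lemma pchar0_mulrnI n u v : u *+ n.+1 = v *+ n.+1 -> u = v.
Proof.
have n0 : n.+1%:R != 0 :> F by rewrite ((pcharf0P F).1 charF0).
rewrite -!(scaler_nat (R := F)) => /(congr1 ( *:%R n.+1%:R^-1)).
by rewrite !scalerA mulVf // !scale1r.
Qed.

Lemma assoc_swap12 u v w : na_assoc v u w = - na_assoc u v w.
Proof. na_lincomb (na_altl (u + v) w [-] na_altl u w [-] na_altl v w). Qed.

Lemma assoc_swap23 u v w : na_assoc u w v = - na_assoc u v w.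
Proof. na_lincomb (na_altr u (v + w) [-] na_altr u w [-] na_altr u v). Qed.

Lemma assoc_rot u v w : na_assoc v w u = na_assoc u v w.
Proof. by rewrite assoc_swap23 assoc_swap12 opprK. Qed.

(** Kleinfeld's function: it compares the value of d = (-,y,z) at wx with the
    Leibniz expression d(x)w + x d(w) of the product xw. *)
Definition kleinfeld w x y z : A :=
  na_assoc (w ** x) y z - x ** na_assoc w y z - na_assoc x y z ** w.

Lemma kleinfeldE w x y z :
  kleinfeld w x y z =
  na_assoc (w ** x) y z - x ** na_assoc w y z - na_assoc x y z ** w.
Proof. by []. Qed.

(** The identity (wx,y,z) - (w,xy,z) + (w,x,yz) = w(x,y,z) + (w,x,y)z of any
    algebra, rewritten by the skew-symmetry of the associator. *)
Lemma kleinfeld_alt_sum w x y z :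
  kleinfeld w x y z - kleinfeld x y z w + kleinfeld y z w x
  = na_comm w (na_assoc x y z) - na_comm x (na_assoc w y z)
    + na_comm y (na_assoc w x z) - na_comm z (na_assoc w x y).
Proof.
na_lincomb (kleinfeldE w x y z [-] kleinfeldE x y z w [+] kleinfeldE y z w x
  [-] assoc_rot w (x ** y) z [-] assoc_rot (y ** z) w x
  [+] eq_mull y (assoc_rot w x z) [+] eq_mulr x (assoc_rot w y z)
  [+] eq_mull z (assoc_rot y w x) [+] eq_mulr y (assoc_rot z w x)).
Qed.

Lemma kleinfeld_swap34 w x y z : kleinfeld w x z y = - kleinfeld w x y z.
Proof.
na_lincomb (kleinfeldE w x z y [+] kleinfeldE w x y z
  [+] assoc_swap23 (w ** x) y z [-] eq_mull x (assoc_swap23 w y z)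
  [-] eq_mulr w (assoc_swap23 x y z)).
Qed.

(** The right-hand side of kleinfeld_alt_sum changes its sign under a cyclic
    shift of the four arguments. *)
Lemma kleinfeld_rot w x y z : kleinfeld z w x y = - kleinfeld w x y z.
Proof.
na_lincomb (kleinfeld_alt_sum w x y z [+] kleinfeld_alt_sum x y z w
  [+] eq_comml x (assoc_rot w y z) [-] eq_comml y (assoc_rot w x z)
  [+] eq_comml z (assoc_rot w x y)).
Qed.

Lemma kleinfeld_swap12 w x y z : kleinfeld x w y z = - kleinfeld w x y z.
Proof.
rewrite (kleinfeld_rot w y z x) (kleinfeld_rot y z x w) kleinfeld_swap34.
by rewrite (kleinfeld_rot x y z w) (kleinfeld_rot y z w x) !opprK.
Qed.

Lemma kleinfeld_swap23 w x y z : kleinfeld w y x z = - kleinfeld w x y z.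
Proof.
by rewrite (kleinfeld_rot y x z w) kleinfeld_swap12 (kleinfeld_rot x y z w).
Qed.

(** The definition skew-symmetrized in w and x. *)
Lemma kleinfeld_skew_part w x y z :
  kleinfeld w x y z *+ 2 =
  na_assoc (na_comm w x) y z + na_comm w (na_assoc x y z)
  - na_comm x (na_assoc w y z).
Proof.
na_lincomb (kleinfeldE w x y z [-] kleinfeldE x w y z
  [+] kleinfeld_swap12 w x y z).
Qed.

Lemma kleinfeld_pairs w x y z : kleinfeld y z w x = kleinfeld w x y z.
Proof.
by rewrite (kleinfeld_rot z w x y) (kleinfeld_rot w x y z) opprK.
Qed.

Lemma kleinfeld_commE w x y z :
  kleinfeld w x y z =
  na_assoc (na_comm w x) y z + na_assoc (na_comm y z) w x.
Proof.
na_lincomb (kleinfeld_skew_part w x y z [+] kleinfeld_skew_part y z w x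
  [-] kleinfeld_alt_sum w x y z [-] kleinfeld_rot y z w x
  [-] eq_comml y (assoc_rot z w x) [+] eq_comml z (assoc_rot y w x)).
Qed.

(** The failure of the Jacobi identity, written with operators acting on w. *)
Lemma assoc_comm_comm w x y :
  na_assoc w x y *+ 6 =
  na_comm (na_comm w x) y - na_comm (na_comm w y) x - na_comm w (na_comm x y).
Proof.
na_lincomb (assoc_swap23 w x y [+] assoc_swap12 w x y [-] assoc_rot w x y
  [+] assoc_swap23 y w x [+] 2 [*] assoc_rot y w x).
Qed.

Lemma comm_assoc_l p q z w :
  na_comm p (na_assoc q z w) =
  na_assoc (na_comm p z) q w + na_assoc p q (na_comm z w)
  + na_comm (na_assoc p q z) w.
Proof.
na_lincomb (kleinfeld_skew_part p z q w [+] kleinfeld_skew_part z w p q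
  [-] 2 [*] kleinfeld_pairs p q z w [-] 2 [*] kleinfeld_swap23 p q z w
  [+] eq_comml p (assoc_swap12 q z w) [-] assoc_rot (na_comm z w) p q
  [-] eq_comml z (assoc_rot w p q) [+] eq_comml w (assoc_rot z p q)).
Qed.

Lemma comm_assoc_r p q z w :
  na_comm q (na_assoc p z w) =
  - (na_assoc p (na_comm q z) w + na_assoc p q (na_comm z w)
     + na_comm (na_assoc p q z) w).
Proof.
na_lincomb (comm_assoc_l q p z w [+] assoc_swap12 p (na_comm q z) w
  [+] assoc_swap12 p q (na_comm z w) [+] eq_commr w (assoc_swap12 p q z)).
Qed.

Lemma assoc_comm_swap p q y z :
  na_assoc (na_comm p y) q z + na_assoc (na_comm p z) q y =
  - na_comm (na_assoc p q y) z - na_comm (na_assoc p q z) y.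
Proof.
na_lincomb (eq_comml p (assoc_swap23 q y z)
  [-] comm_assoc_l p q y z [-] comm_assoc_l p q z y).
Qed.

Lemma assoc_comm_shift p q y z :
  (na_assoc (na_comm p y) q z - na_assoc p (na_comm q z) y) *+ 2 =
  - (na_assoc p q (na_comm y z) + na_comm (na_assoc p q y) z
     + na_comm y (na_assoc p q z)).
Proof.
na_lincomb (2 [*] kleinfeld_swap23 p q y z [+] 2 [*] kleinfeld_pairs p q y z
  [-] kleinfeld_skew_part y z p q [-] 2 [*] kleinfeld_commE p y q z
  [-] 2 [*] assoc_swap12 p (na_comm q z) y [+] assoc_rot (na_comm y z) p q
  [+] eq_comml y (assoc_rot z p q) [-] eq_comml z (assoc_rot y p q)).
Qed.

Lemma assoc_comm_slot r q z w :
  na_assoc r q (na_comm z w) + na_assoc (na_comm r q) z w *+ 2 =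
  na_comm (na_assoc r q z) w + na_comm z (na_assoc r q w).
Proof.
na_lincomb (kleinfeld_skew_part z w r q [-] 2 [*] kleinfeld_pairs r q z w
  [-] 2 [*] kleinfeld_commE r q z w [+] assoc_rot (na_comm z w) r q
  [-] eq_comml z (assoc_rot w r q) [+] eq_comml w (assoc_rot z r q)).
Qed.

(** Both sides are the commutator of (p,x,y) and (q,z,w). *)
Lemma comm_assoc_assoc p q x y z w :
  let r := na_assoc p x y in
  let s := na_assoc q z w in
  na_assoc (na_comm r z) q w + na_assoc r q (na_comm z w)
  + na_comm (na_assoc r q z) w =
  na_assoc p (na_comm s x) y + na_assoc p s (na_comm x y)
  + na_comm (na_assoc p s x) y.
Proof.
move=> r s; rewrite {}/r {}/s; symmetry.
na_lincomb (comm_assoc_l (na_assoc p x y) q z w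
  [+] comm_assoc_r p (na_assoc q z w) x y).
Qed.

(** The identity assoc_comm_slot for 6(p,x,y) in the place of r; the commutator
    of r and q is given by comm_assoc_r. *)
Lemma assoc_comm_slot6 p q x y z w :
  let r := na_comm (na_comm p x) y - na_comm (na_comm p y) x
           - na_comm p (na_comm x y) in
  na_assoc r q (na_comm z w) - na_comm (na_assoc r q z) w
  - na_comm z (na_assoc r q w) =
  - na_assoc (na_assoc p (na_comm q x) y + na_assoc p q (na_comm x y)
              + na_comm (na_assoc p q x) y) z w *+ 12.
Proof.
move=> r; rewrite {}/r -assoc_comm_comm.
have E : na_comm (na_assoc p x y) q =
    na_assoc p (na_comm q x) y + na_assoc p q (na_comm x y)
    + na_comm (na_assoc p q x) y.
  symmetry; na_lincomb (comm_assoc_r p q x y).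
rewrite -E.
na_lincomb (6 [*] assoc_comm_slot (na_assoc p x y) q z w).
Qed.

(** The identity comm_assoc_assoc multiplied by 6, with both inner associators
    expressed by commutators. *)
Lemma comm_assoc_assoc6 p q x y z w :
  let r := na_comm (na_comm p x) y - na_comm (na_comm p y) x
           - na_comm p (na_comm x y) in
  let s := na_comm (na_comm q z) w - na_comm (na_comm q w) z
           - na_comm q (na_comm z w) in
  na_assoc (na_comm r z) q w + na_assoc r q (na_comm z w)
  + na_comm (na_assoc r q z) w =
  na_assoc p (na_comm s x) y + na_assoc p s (na_comm x y)
  + na_comm (na_assoc p s x) y.
Proof.
move=> r s; rewrite {}/r {}/s -!assoc_comm_comm.
na_lincomb (6 [*] comm_assoc_assoc p q x y z w).
Qed.

(** An element that commutes with everything also associates with everything,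
    as 3(d,u,v) is a combination of commutators with d. *)
Lemma comm_central_assoc d : (forall v, na_comm d v = 0) ->
  forall u v, na_assoc d u v = 0.
Proof.
move=> dC u v; apply: (@pchar0_mulrnI 2).
na_lincomb (eq_mull u (dC v) [+] eq_mulr v (dC u) [-] dC (u ** v)
  [-] assoc_rot d u v [+] assoc_swap12 d u v).
Qed.

Lemma assoc_sqr u z : na_assoc u (u ** u) z = 0.
Proof.
apply: (@pchar0_mulrnI 1).
na_lincomb (2 [*] assoc_swap12 (u ** u) u z [-] kleinfeld_swap12 u u u z
  [+] 2 [*] kleinfeldE u u u z [-] eq_mull u (assoc_swap12 u u z)
  [-] eq_mulr u (assoc_swap12 u u z)).
Qed.

Lemma na_comm0l v : na_comm 0 v = 0 :> A.
Proof. by rewrite /na_comm na_mul0l na_mul0r subrr. Qed.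
End AlternativeAlgebras.

(** * Associators of two words of commutators *)

Section Phi.
Variables (F : fieldType) (A : altAlgType F).
Hypothesis charF0 : [pchar F] =i pred0.
Variables a b : A.
Implicit Types (s t : seq A) (u v w x y z : A).

(** The long commutators of a and b with the words s and t, paired by the
    associator with z and skew-symmetrized in a and b. *)
Definition phi s t z : A :=
  na_assoc (na_lcomm a s) (na_lcomm b t) z
  - na_assoc (na_lcomm b s) (na_lcomm a t) z.

Lemma lcomm_rcons u s x : na_lcomm u (rcons s x) = na_comm (na_lcomm u s) x.
Proof. exact: foldl_rcons. Qed.

Lemma phiC s t z : phi s t z = phi t s z.
Proof.
rewrite /phi; na_lincomb (assoc_swap12 (na_lcomm b t) (na_lcomm a s) z
  [-] assoc_swap12 (na_lcomm a t) (na_lcomm b s) z).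
Qed.

Lemma phi_rcons_swap s t y z :
  phi (rcons s y) t z + phi (rcons s z) t y =
  - na_comm (phi s t y) z - na_comm (phi s t z) y.
Proof.
rewrite /phi !lcomm_rcons.
na_lincomb (assoc_comm_swap (na_lcomm a s) (na_lcomm b t) y z
  [-] assoc_comm_swap (na_lcomm b s) (na_lcomm a t) y z).
Qed.

Lemma phi_rcons_shift s t y z :
  (phi (rcons s y) t z - phi s (rcons t z) y) *+ 2 =
  - (phi s t (na_comm y z) + na_comm (phi s t y) z + na_comm y (phi s t z)).
Proof.
rewrite /phi !lcomm_rcons.
na_lincomb (assoc_comm_shift (na_lcomm a s) (na_lcomm b t) y z
  [-] assoc_comm_shift (na_lcomm b s) (na_lcomm a t) y z).
Qed.

(** The two rules for phi with m letters, z included: it is alternating in the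
    last letter of s and z, and the last letter of s may take the place of z
    while z is appended to t. *)
Definition phi_alt m := forall s t y z, (size s + size t).+2 = m ->
  phi (rcons s y) t z = - phi (rcons s z) t y /\
  phi (rcons s y) t z = phi s (rcons t z) y.

(** The values of phi with m letters commute with everything, and phi with m
    letters vanishes when z is a commutator. *)
Definition phi_central m := forall s t z, (size s + size t).+1 = m ->
  (forall v, na_comm (phi s t z) v = 0) /\
  (forall y, phi s t (na_comm y z) = 0).

Lemma phi_central_alt m : phi_central m -> phi_alt m.+1.
Proof.
move=> cm s t y z [/cm st]; have [cy _] := st y; have [cz dz] := st z.
split.
  na_lincomb (phi_rcons_swap s t y z [-] cy z [-] cz y).
apply: (pchar0_mulrnI charF0 (n := 1)).
na_lincomb (phi_rcons_shift s t y z [-] dz y [-] cy z [+] cz y).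
Qed.

(** ** Four and five letters next to a fixed word *)

Section Letters.
Variables (n : nat) (s0 : seq A) (size_s0 : size s0 = n).
Hypothesis c2 : phi_central n.+2.
Hypothesis c3 : phi_central n.+3.
Hypothesis a4 : phi_alt n.+4.

(** Under the above hypotheses, h is alternating and all the placements of its
    four letters agree. *)
Local Notation h x1 x2 x3 x4 :=
  (phi (rcons (rcons (rcons s0 x1) x2) x3) [::] x4).

Lemma h34 x1 x2 x3 x4 : h x1 x2 x4 x3 = - h x1 x2 x3 x4.
Proof. by apply: (proj1 (a4 _ _ _)); rewrite !size_rcons addn0 size_s0. Qed.

Lemma h_shift1 x1 x2 x3 x4 :
  phi (rcons (rcons s0 x1) x2) [:: x4] x3 = h x1 x2 x3 x4.
Proof.
by symmetry; apply: (proj2 (a4 _ _ _)); rewrite !size_rcons addn0 size_s0.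
Qed.

Lemma h_shift2 x1 x2 x3 x4 :
  phi (rcons s0 x1) [:: x4; x3] x2 = h x1 x2 x3 x4.
Proof.
rewrite -h_shift1; symmetry; apply: (proj2 (a4 _ _ _)).
by rewrite !size_rcons size_s0 addn1.
Qed.

Lemma h23 x1 x2 x3 x4 : h x1 x3 x2 x4 = - h x1 x2 x3 x4.
Proof.
rewrite -!h_shift1; apply: (proj1 (a4 _ _ _)).
by rewrite !size_rcons size_s0 addn1.
Qed.

Lemma h12 x1 x2 x3 x4 : h x2 x1 x3 x4 = - h x1 x2 x3 x4.
Proof.
rewrite -!h_shift2; apply: (proj1 (a4 _ _ _)).
by rewrite size_s0 addn2.
Qed.

(** This is assoc_comm_slot6 for p = [a,s0,x1] and q = b, minus the same with a
    and b exchanged: the terms with two or three letters besides s0 drop out. *)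
Lemma h_comm x1 x2 x3 x4 x5 :
  h x1 x2 x3 (na_comm x4 x5) =
  na_comm (h x1 x2 x3 x4) x5 - na_comm (h x1 x2 x3 x5) x4.
Proof.
have [cx _] := c3 (s := rcons s0 x1) (t := [:: x2]) x3
   ltac:(by rewrite size_rcons size_s0 addn1).
have c3' := c3 (s := rcons (rcons s0 x1) (na_comm x2 x3)) (t := [::]) _
   ltac:(by rewrite !size_rcons size_s0 addn0).
have [c4 _] := c3' x4; have [c5 d5] := c3' x5.
have c2' := c2 (s := rcons s0 x1) (t := [::]) _
   ltac:(by rewrite size_rcons size_s0 addn0).
have [c2x _] := c2' x2; have [_ c2y] := c2' x3.
apply: (pchar0_mulrnI charF0 (n := 1)).
pose p u := na_lcomm u (rcons s0 x1).
move: (assoc_comm_slot6 (p a) b x2 x3 x4 x5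
  [-] assoc_comm_slot6 (p b) a x2 x3 x4 x5
  [+] d5 x4 [-] c4 x5 [+] c5 x4
  [-] 12 [*] comm_central_assoc charF0 cx x4 x5
  [-] 12 [*] eq_assocl x4 x5 (c2y x2)
  [-] 12 [*] eq_assocl x4 x5 (c2x x3)
  [+] h23 x1 x2 x3 (na_comm x4 x5) [-] eq_commr x5 (h23 x1 x2 x3 x4)
  [+] eq_commr x4 (h23 x1 x2 x3 x5)).
rewrite /p /phi !lcomm_rcons /na_lcomm /= => E.
na_lincomb E.
Qed.

Lemma h_comm3 x1 x2 x3 x4 x5 :
  h x1 x2 (na_comm x3 x4) x5 =
  na_comm (h x1 x2 x3 x5) x4 - na_comm (h x1 x2 x4 x5) x3.
Proof.
na_lincomb (h34 x1 x2 (na_comm x3 x4) x5 [-] h_comm x1 x2 x5 x3 x4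
  [-] eq_commr x4 (h34 x1 x2 x3 x5) [+] eq_commr x3 (h34 x1 x2 x4 x5)).
Qed.

Lemma h_comm2 x1 x2 x3 x4 x5 :
  h x1 (na_comm x2 x3) x4 x5 =
  na_comm (h x1 x2 x4 x5) x3 - na_comm (h x1 x3 x4 x5) x2.
Proof.
na_lincomb (h23 x1 (na_comm x2 x3) x4 x5 [-] h_comm3 x1 x4 x2 x3 x5
  [-] eq_commr x3 (h23 x1 x2 x4 x5) [+] eq_commr x2 (h23 x1 x3 x4 x5)).
Qed.

(** Five letters, read from left to right through the first word, the last
    argument, and the second word backwards. *)
Local Notation U4 x1 x2 x3 x4 x5 :=
  (phi (rcons (rcons (rcons (rcons s0 x1) x2) x3) x4) [::] x5).
Local Notation U1 x1 x2 x3 x4 x5 := (phi (rcons s0 x1) [:: x5; x4; x3] x2).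

Lemma U4_swap x1 x2 x3 x4 x5 : U4 x1 x2 x3 x4 x5 + U4 x1 x2 x3 x5 x4 =
  - na_comm (h x1 x2 x3 x4) x5 - na_comm (h x1 x2 x3 x5) x4.
Proof. exact: phi_rcons_swap. Qed.

Lemma U1_swap x1 x2 x3 x4 x5 : U1 x1 x2 x3 x4 x5 + U1 x1 x3 x2 x4 x5 =
  - na_comm (h x1 x2 x4 x5) x3 - na_comm (h x1 x3 x4 x5) x2.
Proof.
rewrite !(phiC (rcons s0 x1)).
have := phi_rcons_swap [:: x5; x4] (rcons s0 x1) x3 x2.
rewrite !(phiC [:: x5; x4]) !h_shift2 /= => E; na_lincomb E.
Qed.

(** Three exchanges, each of which costs a commutator inside h. *)
Lemma U4_U1 x1 x2 x3 x4 x5 : U4 x1 x2 x3 x4 x5 = U1 x1 x2 x3 x4 x5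
  - h x1 (na_comm x2 x3) x4 x5 - h x1 x2 (na_comm x3 x4) x5
  - h x1 x2 x3 (na_comm x4 x5).
Proof.
apply: (pchar0_mulrnI charF0 (n := 1)).
have E4 := phi_rcons_shift (rcons (rcons (rcons s0 x1) x2) x3) [::] x4 x5.
have E3 := phi_rcons_shift (rcons (rcons s0 x1) x2) [:: x5] x3 x4.
have E2 := phi_rcons_shift (rcons s0 x1) [:: x5; x4] x2 x3.
rewrite /= !h_shift1 in E3; rewrite /= !h_shift2 in E2.
rewrite /= in E4.
na_lincomb (E4 [+] E3 [+] E2 [+] h_comm x1 x2 x3 x4 x5
  [+] h_comm3 x1 x2 x3 x4 x5 [+] h_comm2 x1 x2 x3 x4 x5).
Qed.

(** This is comm_assoc_assoc6 for p = [a,s0,x1] and q = b, minus the same with a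
    and b exchanged. *)
Lemma U4_U1_exchange x1 x2 x3 x4 x5 :
  U4 x1 x2 x3 x4 x5 - U4 x1 x3 x2 x4 x5 - h x1 (na_comm x2 x3) x4 x5
  + h x1 x2 x3 (na_comm x4 x5) *+ 2 + na_comm (h x1 x2 x3 x4) x5 *+ 2
  = U1 x1 x3 x2 x5 x4 - U1 x1 x3 x2 x4 x5 - h x1 x3 x2 (na_comm x4 x5)
    + h x1 (na_comm x2 x3) x5 x4 *+ 2 + na_comm (h x1 x2 x5 x4) x3 *+ 2.
Proof.
have c23 := c3 (s := rcons (rcons s0 x1) (na_comm x2 x3)) (t := [::]) _
  ltac:(by rewrite !size_rcons size_s0 addn0).
have [ctr4 _] := c23 x4; have [_ van5] := c23 x5.
have c45 := c3 (s := rcons s0 x1) (t := [:: na_comm x4 x5]) _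
  ltac:(by rewrite !size_rcons size_s0 addn1).
have [ctr2 _] := c45 x2; have [_ van3] := c45 x3.
pose p u := na_lcomm u (rcons s0 x1).
move: (comm_assoc_assoc6 (p a) b x2 x3 x4 x5
  [-] comm_assoc_assoc6 (p b) a x2 x3 x4 x5
  [+] van5 x4 [+] ctr4 x5 [-] van3 x2 [-] ctr2 x3
  [+] h23 x1 x2 x3 (na_comm x4 x5) [+] eq_commr x5 (h23 x1 x2 x3 x4)
  [-] h_shift2 x1 x3 x2 (na_comm x4 x5)
  [+] h_shift2 x1 (na_comm x2 x3) x5 x4 [-] h_shift2 x1 (na_comm x2 x3) x4 x5
  [-] h34 x1 (na_comm x2 x3) x5 x4
  [+] eq_commr x3 (h_shift2 x1 x2 x5 x4) [-] eq_commr x3 (h_shift2 x1 x2 x4 x5)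
  [-] eq_commr x3 (h34 x1 x2 x5 x4)).
rewrite /p /phi !lcomm_rcons /na_lcomm /= => E.
na_lincomb E.
Qed.

(** The relation U4_U1_exchange, after U4 is expressed by U1 and the values of
    U1 cancel. *)
Lemma h_comm_sum x1 x2 x3 x4 x5 :
  na_comm (h x1 x3 x4 x5) x2 - na_comm (h x1 x2 x4 x5) x3
  + na_comm (h x1 x2 x3 x5) x4 - na_comm (h x1 x2 x3 x4) x5 = 0.
Proof.
symmetry; na_lincomb (U4_U1_exchange x1 x2 x3 x4 x5 [+] U4_swap x1 x3 x2 x4 x5
  [-] U4_U1 x1 x2 x3 x4 x5 [-] U4_U1 x1 x3 x2 x5 x4 [-] U1_swap x1 x2 x3 x4 x5
  [+] 2 [*] h_comm2 x1 x2 x3 x4 x5 [-] h_comm x1 x2 x3 x4 x5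
  [-] h_comm x1 x3 x2 x4 x5 [+] 2 [*] h_comm2 x1 x2 x3 x5 x4
  [+] h_comm3 x1 x2 x3 x4 x5 [+] h_comm2 x1 x3 x2 x5 x4
  [+] h_comm3 x1 x3 x2 x5 x4 [+] h_comm x1 x3 x2 x5 x4
  [-] 2 [*] eq_commr x5 (h23 x1 x2 x3 x4) [+] eq_commr x4 (h23 x1 x2 x3 x5)
  [+] 3 [*] eq_commr x3 (h34 x1 x2 x4 x5)
  [-] 2 [*] eq_commr x2 (h34 x1 x3 x4 x5)).
Qed.

Lemma h_comm_swap x1 x2 x3 x4 x5 :
  na_comm (h x2 x3 x4 x5) x1 = - na_comm (h x1 x3 x4 x5) x2.
Proof.
na_lincomb (h_comm_sum x1 x2 x3 x4 x5 [+] h_comm_sum x2 x1 x3 x4 x5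
  [+] eq_commr x3 (h12 x1 x2 x4 x5) [-] eq_commr x4 (h12 x1 x2 x3 x5)
  [+] eq_commr x5 (h12 x1 x2 x3 x4)).
Qed.

Lemma h_rot x1 x2 x3 x4 : h x4 x1 x2 x3 = - h x1 x2 x3 x4.
Proof.
na_lincomb (h12 x1 x4 x2 x3 [-] h23 x1 x2 x4 x3 [+] h34 x1 x2 x3 x4).
Qed.

Lemma h_comm_swap_last x1 x2 x3 x4 x5 :
  na_comm (h x1 x2 x3 x5) x4 = - na_comm (h x1 x2 x3 x4) x5.
Proof.
na_lincomb (eq_commr x5 (h_rot x1 x2 x3 x4) [+] eq_commr x4 (h_rot x1 x2 x3 x5)
  [-] h_comm_swap x5 x4 x1 x2 x3).
Qed.

(** By the preceding lemma the four terms of h_comm_sum are equal. *)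
Lemma h_central x1 x2 x3 x4 x5 : na_comm (h x1 x2 x3 x4) x5 = 0.
Proof.
apply: (pchar0_mulrnI charF0 (n := 3)).
na_lincomb (h_comm_swap_last x1 x2 x3 x4 x5 [-] h_comm_sum x1 x2 x3 x4 x5
  [+] h_comm_swap_last x1 x3 x4 x2 x5 [-] eq_commr x5 (h34 x1 x3 x2 x4)
  [+] eq_commr x5 (h23 x1 x2 x3 x4)
  [-] h_comm_swap_last x1 x2 x4 x3 x5 [+] eq_commr x5 (h34 x1 x2 x3 x4)).
Qed.
End Letters.

(** Letters of t move to s one at a time, at the cost of a sign each. *)
Lemma phi_catrev m s t z : phi_alt m -> (size s + size t).+1 = m ->
  phi s t z = (-1) ^+ size t *: phi (s ++ rev t) [::] z.
Proof.
move=> am; elim/last_ind: t s => [|t w IH] s sz.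
  by rewrite cats0 scale1r.
have sz' : (size s + size t).+2 = m by rewrite -sz size_rcons addnS.
have [_ <-] := am s t z w sz'; have [-> _] := am s t z w sz'.
rewrite (IH (rcons s w)); last by rewrite size_rcons addSn.
by rewrite size_rcons rev_rcons cat_rcons exprS mulN1r scaleNr.
Qed.

Lemma phi_central_step n :
  phi_central n.+2 -> phi_central n.+3 -> phi_alt n.+4 -> phi_central n.+4.
Proof.
move=> c2 c3 a4.
have nil_case s z : size s = n.+3 ->
    (forall v, na_comm (phi s [::] z) v = 0) /\
    (forall y, phi s [::] (na_comm y z) = 0).
  case/lastP: s => [//|s x3]; case/lastP: s => [|s x2]; first by [].
  case/lastP: s => [|s x1]; first by [].
  rewrite !size_rcons => -[sz]; have C := h_central sz c2 c3 a4.
  split=> [v|y]; first exact: C.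
  by rewrite (h_comm sz c2 c3 a4) !C subrr.
move=> s t z sz.
have sz' : size (s ++ rev t) = n.+3.
  by rewrite size_cat size_rev; case: sz.
split=> [v|y]; rewrite (phi_catrev _ a4 sz); have [C D] := nil_case _ z sz'.
  by rewrite /na_comm na_scaleAl na_scaleAr -scalerBr -/(na_comm _ _) C scaler0.
by rewrite D scaler0.
Qed.

Hypothesis ab0 : forall z, na_assoc a b z = 0.

(** ** Reversal of the letters *)

Lemma phi_nil z : phi [::] [::] z = 0.
Proof. by rewrite /phi /na_lcomm /= (assoc_swap12 a b) ab0 oppr0 subrr. Qed.

Lemma phi_zero_central m :
  (forall s t z, (size s + size t).+1 = m -> phi s t z = 0) -> phi_central m.
Proof. by move=> z0 s t z st; split=> *; rewrite !z0 // na_comm0l. Qed.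

Lemma phi_alt_swap m s1 s2 y w z : phi_alt m ->
  (size s1 + size s2).+3 = m ->
  phi (s1 ++ [:: y, w & s2]) [::] z = - phi (s1 ++ [:: w, y & s2]) [::] z.
Proof.
move=> am sz.
(* Moving s2 to the second word brings the two letters to the end of the first
   one; s2 is then reversed. *)
have E u v : phi (s1 ++ [:: u, v & s2]) [::] z =
    (-1) ^+ size s2 *: phi (rcons (rcons s1 u) v) (rev s2) z.
  have := phi_catrev z am (s := rcons (rcons s1 u) v) (t := rev s2).
  rewrite size_rev !size_rcons revK !cat_rcons => -> //.
  by rewrite scalerA -exprD addnn -mul2n exprM sqrrN expr1n expr1n scale1r.
rewrite !E -scalerN; congr (_ *: _).
have sz1 u : (size (rcons s1 u) + size (rev s2)).+2 = m.
  by rewrite size_rcons size_rev addSn.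
have sz2 : (size s1 + size (rcons (rev s2) z)).+2 = m.
  by rewrite size_rcons size_rev addnS.
rewrite (am _ _ w z (sz1 y)).2 (am _ _ y z (sz1 w)).2.
exact: (am _ _ y w sz2).1.
Qed.

Lemma phi_alt_move m s1 s2 y z : phi_alt m ->
  (size s1 + size s2).+2 = m ->
  phi (s1 ++ rcons s2 y) [::] z = (-1) ^+ size s2 *: phi (s1 ++ y :: s2) [::] z.
Proof.
move=> am; elim: s2 s1 => [|w s2 IH] s1 sz; first by rewrite scale1r.
rewrite /= -cat_rcons IH; last by rewrite size_rcons addSn -sz /= addnS.
rewrite cat_rcons (phi_alt_swap _ _ _ am); last by rewrite -sz /= addnS.
by rewrite exprS mulN1r scaleNr scalerN.
Qed.

Lemma phi_alt_revword m s1 s2 z : phi_alt m -> (size s1 + size s2).+1 = m ->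
  phi (s1 ++ rev s2) [::] z =
  (-1) ^+ 'C(size s2, 2) *: phi (s1 ++ s2) [::] z.
Proof.
move=> am; elim: s2 s1 => [|y s2 IH] s1 sz; first by rewrite scale1r.
rewrite rev_cons (phi_alt_move _ _ am); last by rewrite -sz size_rev /= addnS.
rewrite -cat_rcons IH; last by rewrite size_rcons addSn -sz /= addnS.
by rewrite cat_rcons scalerA -exprD size_rev /= binS bin1 addnC.
Qed.

(** Reversing s in two ways, through the symmetry in s and t and through
    skew-symmetry, gives the signs (-1)^(m-1) and (-1)^((m-1)(m-2)/2). *)
Lemma phi_alt_eq0 m s z : phi_alt m -> (size s).+1 = m -> odd 'C(m, 2) ->
  phi s [::] z = 0.
Proof.
move=> am sz om.
have E : phi s [::] z = - phi s [::] z.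
  rewrite {1}phiC (phi_catrev _ am) //= (phi_alt_revword (s1 := [::]) _ am) //.
  rewrite scalerA -exprD -signr_odd; move: om.
  by rewrite -sz binS bin1 addnC => -> /=; rewrite scaleN1r.
apply: (pchar0_mulrnI charF0 (n := 1)).
by rewrite mul0rn mulr2n {1}E addNr.
Qed.

Lemma phi_alt_central m : phi_alt m -> odd 'C(m, 2) -> phi_central m.
Proof.
move=> am om; apply: phi_zero_central => s t z sz.
rewrite (phi_catrev _ am sz) (phi_alt_eq0 _ am) ?scaler0 //.
by rewrite size_cat size_rev.
Qed.

Lemma phi_central1 : phi_central 1.
Proof.
by apply: phi_zero_central => -[|? ?] [|? ?] z //= _; rewrite phi_nil.
Qed.

Lemma phi_central_all m : phi_central m.+1.
Proof.
have a2 := phi_central_alt phi_central1.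
have c2 := phi_alt_central a2 isT; have a3 := phi_central_alt c2.
have c3 := phi_alt_central a3 isT.
suff: phi_central m.+1 /\ phi_central m.+2 /\ phi_central m.+3 by case.
elim: m => [|m [cm1 [cm2 cm3]]]; first by split; [exact: phi_central1|].
have cm4 := phi_central_step cm2 cm3 (phi_central_alt cm3).
by do 2?[split => //].
Qed.

Lemma phi_eq0 m s z : (size s).+1 = m -> odd 'C(m, 2) ->
  phi s [::] z = 0.
Proof.
case: m => [|[|m]] // sz om.
exact: (phi_alt_eq0 z (phi_central_alt (@phi_central_all m)) sz om).
Qed.
End Phi.

Theorem proposition3p2 (F : fieldType) (charF0 : [pchar F] =i pred0)
    (k n : nat) (hn : n = (4 * k + 2)%N \/ n = (4 * k + 3)%N)
    (a : AltX F) (x : nat -> nat) :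
  na_u n a (fun i => freeAlt_gen (x i) : AltX F) = 0.
Proof.
have n0 : (0 < n)%N by case: hn => ->; rewrite addnS.
apply: (phi_eq0 charF0 (assoc_sqr charF0 a) (m := n)).
  by rewrite size_map size_iota subn1 prednK.
(* The binomial n(n-1)/2 is (2k+1)(4k+1), respectively (4k+3)(2k+1). *)
rewrite bin2; case: hn => ->.
  have -> : ((4 * k + 2) * (4 * k + 2).-1 =
             ((2 * k + 1) * (4 * k + 1)).*2)%N by nia.
  by rewrite doubleK oddM; apply/andP; split; lia.
have -> : ((4 * k + 3) * (4 * k + 3).-1 =
           ((4 * k + 3) * (2 * k + 1)).*2)%N by nia.
by rewrite doubleK oddM; apply/andP; split; lia.
Qed.
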